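(* Let $H$ be a finite simple graph with two distinct vertices $u,w$ such that $d_H(u,w)\ge 2$. Then for every finite simple graph $G$, $\pi(G_H)\le \pi(G)+\pi(H)-1$.
   Context: A vertex colouring $\varphi$ of a graph $G$ is a Thue colouring if there is no $m\ge1$ and no path $v_1\cdots v_{2m}$ (distinct vertices, consecutive ones adjacent) with $\varphi(v_i)=\varphi(v_{i+m})$ for all $1\le i\le m$; $\pi(G)$ is the minimum number of colours of a Thue colouring. The $H$-subdivision $G_H$ of $G$ (with respect to the chosen pair $u,w$) is obtained by, for each edge $v_iv_j\in E(G)$ (with one endpoint designated $v_i$ and the other $v_j$), adding a new copy of $H$, deleting the edge $v_iv_j$, and adding the edge from $v_i$ to the copy of $u$ and the edge from $v_j$ to the copy of $w$. $d_H$ is the shortest-path distance in $H$. *)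

(* Defs.v *)
From HB Require Import structures.
From mathcomp Require Import all_boot.
From mathcomp Require Import boolp.

Set Implicit Arguments.
Unset Strict Implicit.
Unset Printing Implicit Defensive.

Record sgraph := SGraph {
  vertex :> finType;
  adj : rel vertex;
  adj_sym : symmetric adj;
  adj_irr : irreflexive adj
}.

Section Distance.
Variable G : sgraph.
Implicit Types (x y : G) (n : nat).

Definition has_path n x y : bool :=
  [exists p : n.-tuple G,
     [&& path (@adj G) x p, uniq (x :: p) & last x p == y]].

Lemma connect_has_path x y :
  connect (@adj G) x y -> exists n, has_path n x y.
Proof.
case/connectP => p xp ->; case/shortenP: xp => q xq Uq _.
by exists (size q); apply/existsP; exists (in_tuple q); rewrite xq Uq eqxx.
Qed.

(* [None] is the infinite distance between distinct components. *)
Definition dist x y : option nat :=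
  if @idP (connect (@adj G) x y) is ReflectT xy
  then Some (ex_minn (connect_has_path xy)) else None.

Definition dist_geq x y n : bool :=
  if dist x y is Some d then n <= d else true.

End Distance.

Section Thue.
Variable G : sgraph.

Definition thue_coloring (C : Type) (phi : G -> C) : Prop :=
  ~ exists (m : nat) (v : (m + m).-tuple G),
      [/\ 0 < m, uniq v, sorted (@adj G) v
        & forall i : 'I_m,
            phi (tnth v (lshift m i)) = phi (tnth v (rshift m i))].

Definition thue_colorable (k : nat) : Prop :=
  exists phi : G -> 'I_k, thue_coloring phi.

Lemma thue_colorable_card : thue_colorable #|G|.
Proof.
exists enum_rank => -[m [v [m_gt0 Uv _ /(_ (Ordinal m_gt0)) /enum_rank_inj]]].
move/(tuple_uniqP _ Uv)/(congr1 val) => /= /eqP.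
by rewrite addn0 eq_sym; case: m m_gt0 {v Uv}.
Qed.

Lemma thue_colorable_exists : exists k, `[< thue_colorable k >].
Proof. by exists #|G|; apply/asboolP/thue_colorable_card. Qed.

Definition thue_number : nat := ex_minn thue_colorable_exists.

End Thue.

(* Designation of the endpoints of the edges: [o x y] means that [x], [y] are
   the first and second endpoints of the edge [xy]. *)
Definition orientation (G : sgraph) (o : rel G) : Prop :=
  (forall x y, o x y || o y x = adj x y) /\
  (forall x y, ~~ (o x y && o y x)).

Section Subdivision.
Variables (G : sgraph) (o : rel G) (H : sgraph) (u w : H).

Definition arc : finType := {a : G * G | o a.1 a.2}.

(* [inr (a, h)] is the vertex [h] of the copy of [H] attached to the edge [a]. *)
Definition subdivision_vertex : finType := (G + arc * H)%type.

Definition joined (x : G) (a : arc) (h : H) : bool :=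
  (x == (val a).1) && (h == u) || (x == (val a).2) && (h == w).

Definition subdivision_adj : rel subdivision_vertex := fun s t =>
  match s, t with
  | inl _, inl _ => false
  | inl x, inr (a, h) => joined x a h
  | inr (a, h), inl x => joined x a h
  | inr (a, h), inr (b, k) => (a == b) && adj h k
  end.

Lemma subdivision_adj_sym : symmetric subdivision_adj.
Proof. by case=> [x|[a h]] [y|[b k]] //=; rewrite eq_sym adj_sym. Qed.

Lemma subdivision_adj_irr : irreflexive subdivision_adj.
Proof. by case=> [x|[a h]] //=; rewrite adj_irr andbF. Qed.

Definition subdivision : sgraph :=
  SGraph subdivision_adj_sym subdivision_adj_irr.

End Subdivision.

(* Main.v *)
Require Import Defs.
From mathcomp Require Import all_boot.
From mathcomp Require Import boolp perm zify.

(* Fix Thue colourings c of G with p colours and phi of H with q colours, and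
   let M be one colour class of c. Colour G_H with p - 1 "G-colours" and q
   "H-colours" so that in a repetition the vertices of G, with their colours,
   match up in the two halves; they then form a repetition in G, unless the
   path stays in one copy of H.

   If phi u = phi w =: c0, colour M by c0 and recolour by a fixed G-colour g0,
   in each copy of H, the vertex attached to M. A G-coloured vertex on a path is
   then outside M exactly when both its neighbours have colour c0, and a vertex
   between two G-coloured ones is in M, because u and w are not adjacent.

   If phi u <> phi w and H has a third colour, colour M by g0 and permute the
   H-colours of each copy so that c0 is the colour of a vertex of the copy
   attached to x in G exactly when x is in M: one neighbour on the path then
   tells M from the rest of G. Two colours do not suffice for phi u <> phi w when
   u and w are connected, and otherwise one can make phi u = phi w. *)

Set Implicit Arguments.
Unset Strict Implicit.
Unset Printing Implicit Defensive.

(** * Thue colourings of a single graph *)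

Section Thue.
Variable G : sgraph.
Implicit Types (x y : G) (s : seq G).

Lemma thue_coloringP (C : Type) (phi : G -> C) :
  thue_coloring phi <->
  forall s1 s2, uniq (s1 ++ s2) -> sorted (@adj G) (s1 ++ s2) ->
    map phi s1 = map phi s2 -> s1 = [::].
Proof.
split=> [thue s1 s2 Us ps eq_phi|thue [m [v [m_gt0 Uv pv eq_phi]]]].
  have eq_sz : size s2 = size s1 by rewrite -(size_map phi) -eq_phi size_map.
  case: (posnP (size s1)) => [/size0nil//|sz_gt0]; case: thue.
  have sz_s : size (s1 ++ s2) == size s1 + size s1 by rewrite size_cat eq_sz.
  exists (size s1), (Tuple sz_s); split=> // i.
  have [x0] : inhabited G by case: (s1) sz_gt0 => // x.
  rewrite !(tnth_nth x0) /= !nth_cat ltn_ord ltnNge leq_addr addKn.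
  by rewrite -!(nth_map x0 (phi x0) phi) ?eq_sz ?ltn_ord // eq_phi.
have sz_t : size (take m v) = m by rewrite size_takel // size_tuple leq_addr.
have sz_d : size (drop m v) = m by rewrite size_drop size_tuple addKn.
suff t0 : take m v = [::] by move: m_gt0; rewrite -sz_t t0.
apply: (thue _ (drop m v)); rewrite ?cat_take_drop //.
have x0 := tnth v (lshift m (Ordinal m_gt0)).
apply: (@eq_from_nth _ (phi x0)); first by rewrite !size_map sz_t sz_d.
move=> i; rewrite size_map sz_t => i_lt_m.
rewrite !(nth_map x0) ?sz_t ?sz_d // nth_take // nth_drop.
by have := eq_phi (Ordinal i_lt_m); rewrite !(tnth_nth x0).
Qed.

Lemma thue_number_leq (C : finType) (phi : G -> C) :
  thue_coloring phi -> thue_number G <= #|C|.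
Proof.
move=> thue; rewrite /thue_number; case: ex_minnP => n _; apply.
apply/asboolP; exists (enum_rank \o phi) => -[m [v [m_gt0 Uv pv eq_phi]]].
by case: thue; exists m, v; split=> // i; apply/enum_rank_inj/eq_phi.
Qed.

Lemma thue_numberP : exists phi : G -> 'I_(thue_number G), thue_coloring phi.
Proof. by rewrite /thue_number; case: ex_minnP => n /asboolP. Qed.

Lemma thue_coloring_refine (C D : Type) (phi : G -> C) (psi : G -> D) :
  (forall x y, psi x = psi y -> phi x = phi y) ->
  thue_coloring phi -> thue_coloring psi.
Proof.
move=> ref thue [m [v [m_gt0 Uv pv eq_psi]]].
by apply: thue; exists m, v; split=> // i; apply/ref/eq_psi.
Qed.

Lemma thue_coloring_adj (C : Type) (phi : G -> C) x y :
  thue_coloring phi -> adj x y -> phi x <> phi y.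
Proof.
move=> /thue_coloringP/(_ [:: x] [:: y]) /= + xy eq_phi.
rewrite inE xy eq_phi /= => H; suff: false by [].
suff xDy : x != y by have := H _ _ erefl; rewrite xDy => /(_ erefl erefl).
by apply: contraTneq xy => ->; rewrite adj_irr.
Qed.

Lemma dist_geq2_adj x y : x != y -> dist_geq x y 2 -> ~~ adj x y.
Proof.
move=> xDy; rewrite /dist_geq /dist; case: {-}_ / idP => [cxy|ncxy].
  case: ex_minnP => n _ min_n n_ge2; apply/negP => xy.
  suff: n <= 1 by rewrite leqNgt n_ge2.
  apply: min_n; apply/existsP; exists [tuple y].
  by rewrite /= xy inE xDy eqxx.
by move=> _; apply/negP => /connect1.
Qed.

(* Along a path from [x] to [y] two colours would have to alternate, and the
   path has at least four vertices. *)
Lemma thue_coloring_third_color (C : eqType) (phi : G -> C) x y :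
  thue_coloring phi -> ~~ adj x y -> connect (@adj G) x y ->
  phi x != phi y -> exists2 c, c != phi x & c != phi y.
Proof.
move=> thue nxy /connectP[p0 p0P def_y] phixy.
apply: contrapT => no_c.
have two c : c = phi x \/ c = phi y.
  have [->|cx] := eqVneq c (phi x); first by left.
  by have [->|cy] := eqVneq c (phi y); [right | case: no_c; exists c].
move: p0P def_y; case/shortenP => p xp Up _ def_y {p0}.
case: p => [|a [|b [|d p]]] /= in xp Up def_y.
- by rewrite def_y eqxx in phixy.
- by move: nxy; rewrite def_y; case/andP: xp => ->.
- case/and3P: xp => /(thue_coloring_adj thue) xa /(thue_coloring_adj thue) ab _.
  rewrite def_y in two phixy; case: (two (phi a)) => phia; first by rewrite phia in xa.
  by case: ab; rewrite phia.
case/and4P: xp => xa ab bd _.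
have neq := thue_coloring_adj thue.
have phia : phi a = phi y by case: (two (phi a)) => // E; case: (neq _ _ xa).
have phib : phi b = phi x.
  by case: (two (phi b)) => // E; case: (neq _ _ ab); rewrite phia E.
have phid : phi d = phi y.
  by case: (two (phi d)) => // E; case: (neq _ _ bd); rewrite phib E.
move/thue_coloringP: thue => /(_ [:: x; a] [:: b; d]) /=.
rewrite xa ab bd phia phib phid => thue.
suff U4 : uniq [:: x; a; b; d] by have := thue U4 erefl erefl.
have: uniq ([:: x; a; b; d] ++ p) by [].
by rewrite cat_uniq => /andP[].
Qed.

(** A path stays inside one component, so its colour word is either unchanged or mapped through the
    injective [f], and a repetition for the new colouring is one for [phi]. *)
Lemma thue_coloring_glue (C : eqType) (phi : G -> C) (f : C -> C) x :
  injective f -> thue_coloring phi ->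
  thue_coloring (fun z => if connect (@adj G) x z then f (phi z) else phi z).
Proof.
move=> f_inj /thue_coloringP thue; apply/thue_coloringP => s1 s2 Us ps eq_psi.
apply: (thue _ _ Us ps).
have symc : connect_sym (@adj G) by apply/sym_connect_sym/adj_sym.
have [b conn_b] : exists b, {in s1 ++ s2, forall z, connect (@adj G) x z = b}.
  case: (s1 ++ s2) ps => [|y s] ps; first by exists true.
  exists (connect (@adj G) x y) => z zs.
  by apply/esym/(same_connect_r symc)/(path_connect ps).
have eq_b s : {subset s <= s1 ++ s2} ->
    [seq if connect (@adj G) x z then f (phi z) else phi z | z <- s]
    = map (if b then f else id) (map phi s).
  move=> sS; rewrite -map_comp; apply/eq_in_map => z zs /=.
  by rewrite conn_b ?sS //; case: (b).
move: eq_psi; rewrite !eq_b; last first.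
- by move=> z zs; rewrite mem_cat zs.
- by move=> z zs; rewrite mem_cat zs orbT.
by apply: inj_map; case: (b).
Qed.

(** Passes from lists to positions, so that a key can be recovered from a few neighbouring
    positions. Of the uniqueness of the path only the inequality at distance two is handed on. *)
Lemma key_repetition (C K : Type) (phi : G -> C) (key : G -> K) s1 s2 :
  (forall m (f : nat -> G),
     (forall i, i.+1 < m + m -> adj (f i) (f i.+1)) ->
     (forall i, i.+2 < m + m -> f i != f i.+2) ->
     (forall i, i < m -> phi (f i) = phi (f (m + i))) ->
     forall i, i < m -> key (f i) = key (f (m + i))) ->
  uniq (s1 ++ s2) -> sorted (@adj G) (s1 ++ s2) -> map phi s1 = map phi s2 ->
  map key s1 = map key s2.
Proof.
move=> keyP Us ps eq_phi.
have eq_sz : size s2 = size s1 by rewrite -(size_map phi) -eq_phi size_map.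
case: (posnP (size s1)) => [sz0|sz_gt0].
  by rewrite (size0nil sz0) (size0nil (etrans eq_sz sz0)).
have [x0] : inhabited G by case: (s1) sz_gt0 => // x.
have sz_s : size (s1 ++ s2) = size s1 + size s1 by rewrite size_cat eq_sz.
have nth1 i : i < size s1 -> nth x0 (s1 ++ s2) i = nth x0 s1 i by rewrite nth_cat => ->.
have nth2 i : nth x0 (s1 ++ s2) (size s1 + i) = nth x0 s2 i.
  by rewrite nth_cat ltnNge leq_addr addKn.
apply: (@eq_from_nth _ (key x0)); rewrite !size_map // => i i_lt.
rewrite !(nth_map x0) ?eq_sz // -nth1 // -nth2.
apply: (keyP _ (nth x0 (s1 ++ s2))) => // j j_lt.
- by apply: (sortedP x0 ps); rewrite sz_s.
- by rewrite nth_uniq ?sz_s ?ltn_eqF //; do 2!apply: ltnW.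
- by rewrite nth1 // nth2 -!(nth_map x0 (phi x0) phi) ?eq_sz // eq_phi.
Qed.

End Thue.

(** * Paths in the subdivision and their traces in G *)

Section Subdivision.
Variables (G : sgraph) (o : rel G) (H : sgraph) (u w : H).
Hypothesis o_or : orientation o.
Local Notation S := (subdivision o u w).
Implicit Types (x y : G) (a : Defs.arc o) (h k : H) (s : seq S).

Definition base_vertex (v : S) : option G := if v is inl x then Some x else None.

Definition endpoint x a : bool := (x == (val a).1) || (x == (val a).2).

Lemma joined_endpoint x a h : joined u w x a h -> endpoint x a.
Proof. by rewrite /endpoint; case/orP=> /andP[-> _]; rewrite ?orbT. Qed.

Lemma adj_arc a : adj (val a).1 (val a).2.
Proof. by rewrite -(proj1 o_or) (valP a). Qed.

Lemma endpoint_adj x y a : endpoint x a -> endpoint y a -> x != y -> adj x y.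
Proof.
by case/orP=> /eqP -> /orP[] /eqP ->; rewrite ?eqxx ?adj_arc // adj_sym adj_arc.
Qed.

(** Invariant along a path: [x] is the last vertex of G met, and [v] is [x] itself or lies in a copy
    of H on an edge at [x]. *)
Definition last_base x (v : S) : bool :=
  match v with inl y => y == x | inr (a, _) => endpoint x a end.

(** Between consecutive vertices of G the path stays in one copy of H, whose edge has both as
    endpoints; they differ because [x] does not recur, so they are adjacent. *)
Lemma path_base_vertex x v s :
  last_base x v -> path (@adj S) v s -> uniq s -> inl x \notin s ->
  path (@adj G) x (pmap base_vertex s).
Proof.
elim: s x v => //= z s IHs x v xv /andP[vz zs] /andP[zNs Us].
rewrite inE negb_or => /andP[xDz xNs].
case: z => [y|[b k]] in vz zs zNs xDz * => /=.
  apply/andP; split; last by apply: (IHs y (inl y)) => //=; apply: eqxx.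
  case: v => [x'|[a h]] // in xv vz *.
  apply: (endpoint_adj xv (joined_endpoint vz)).
  by apply: contraNneq xDz => ->.
apply: IHs zs Us xNs => /=; case: v => [x'|[a h]] in xv vz *.
  by move: xv => /= /eqP <-; apply: joined_endpoint vz.
by case/andP: vz => /eqP <-.
Qed.

Lemma sorted_base_vertex s :
  uniq s -> sorted (@adj S) s -> sorted (@adj G) (pmap base_vertex s).
Proof.
elim: s => // -[x|ah] s IHs /= /andP[vNs Us] vs.
  by apply: (path_base_vertex _ vs) => //=.
by apply: IHs => //; apply: path_sorted vs.
Qed.

Lemma pmap_base_vertex_uniq s : uniq s -> uniq (pmap base_vertex s).
Proof.
by move=> Us; apply: (pmap_uniq (g := inl)) Us => -[].
Qed.

Lemma path_in_copy a h s :
  path (@adj S) (inr (a, h)) s -> pmap base_vertex s = [::] ->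
  exists2 t, s = [seq inr (a, k) | k <- t] & path (@adj H) h t.
Proof.
elim: s h => [|[x|[b k]] s IHs] h //=; first by exists [::].
by case/andP=> /andP[/eqP <- hk] /IHs/[apply] -[t -> kt]; exists (k :: t); rewrite //= hk.
Qed.

(** [None] stands for the vertices of the copies of H. When [C] is [option P], [Some None] stands
    for the vertices of M. *)
Definition key (C : Type) (c : G -> C) (v : S) : option C := omap c (base_vertex v).

Lemma thue_coloring_subdivision (C D : Type) (c : G -> C) (psi : S -> D) :
  thue_coloring c ->
  (forall a, thue_coloring (fun h : H => psi (inr (a, h)))) ->
  (forall s1 s2, uniq (s1 ++ s2) -> sorted (@adj S) (s1 ++ s2) ->
     map psi s1 = map psi s2 -> map (key c) s1 = map (key c) s2) ->
  thue_coloring psi.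
Proof.
move=> /thue_coloringP thue_c thue_psi keyP; apply/thue_coloringP => s1 s2 Us ps eq_psi.
have map_base s : map c (pmap base_vertex s) = pmap id (map (key c) s).
  by elim: s => //= -[x|ah] s /= ->.
have base1 : pmap base_vertex s1 = [::].
  apply: (thue_c _ (pmap base_vertex s2)).
  - by rewrite -pmap_cat pmap_base_vertex_uniq.
  - by rewrite -pmap_cat sorted_base_vertex.
  - by rewrite !map_base (keyP _ _ Us ps).
have base2 : pmap base_vertex s2 = [::].
  apply/size0nil; rewrite -(size_map c) map_base -(keyP _ _ Us ps eq_psi).
  by rewrite -map_base base1.
case: s1 => [//|[x|[a h]] s1] in Us ps eq_psi base1 *; first by [].
have [|t def_s ht] := path_in_copy (s := s1 ++ s2) ps.
  by rewrite pmap_cat base2 cats0.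
pose n := (size s1).+1.
have def_all : (inr (a, h) : S) :: s1 ++ s2 = [seq inr (a, k) | k <- h :: t].
  by rewrite def_s.
have def1 : (inr (a, h) : S) :: s1 = [seq inr (a, k) | k <- take n (h :: t)].
  by rewrite map_take -def_all -cat_cons take_size_cat.
have def2 : s2 = [seq inr (a, k) | k <- drop n (h :: t)].
  by rewrite map_drop -def_all -cat_cons drop_size_cat.
move/thue_coloringP: (thue_psi a) => /(_ (take n (h :: t)) (drop n (h :: t))).
rewrite cat_take_drop => take0.
rewrite def1 take0 //; first by rewrite cat_cons def_all in Us; apply: map_uniq Us.
by move: eq_psi; rewrite def1 def2 -!map_comp.
Qed.

(* [c x = None] means that [x] is in the distinguished colour class M. *)
Section Colorings.
Variables (P Q : finType) (c : G -> option P) (phi : H -> Q) (g0 : P) (c0 : Q).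
Hypotheses (c_thue : thue_coloring c) (phi_thue : thue_coloring phi).
Hypothesis uDw : u != w.

Lemma arc_None a : c (val a).1 = None -> c (val a).2 = None -> False.
Proof. by move=> c1 c2; apply: (thue_coloring_adj c_thue (adj_arc a)); rewrite c1 c2. Qed.

(** * Colouring the subdivision when u and w have different colours *)

Section DistinctColors.
Variable e : Q.
Hypotheses (phiDuw : phi u != phi w) (eDu : e != phi u) (eDw : e != phi w).

(** The colour to be exchanged with [c0]: that of the vertex attached to the endpoint in M, or [e],
    found at neither [u] nor [w], if no endpoint is in M. *)
Definition copy_color a : Q :=
  if c (val a).1 == None then phi u else if c (val a).2 == None then phi w else e.

Definition perm_coloring (v : S) : P + Q :=
  match v with
  | inl x => inl (odflt g0 (c x))
  | inr (a, h) => inr (tperm c0 (copy_color a) (phi h))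
  end.

Lemma perm_coloring_joined x a h :
  joined u w x a h -> (perm_coloring (inr (a, h)) == inr c0) = (c x == None).
Proof.
rewrite /= (inj_eq inr_inj) -{2}(tpermR c0 (copy_color a)) (inj_eq perm_inj).
rewrite /copy_color; case/orP => /andP[/eqP -> /eqP ->].
  case: (c (val a).1 =P None) => _; first by rewrite eqxx.
  by case: ifP => _; apply/negbTE; rewrite // eq_sym.
case: (c (val a).1 =P None) => [c1|_].
  by rewrite eq_sym (negPf phiDuw); case: eqP => // /(arc_None c1).
by case: (c (val a).2 =P None) => _; rewrite ?eqxx // eq_sym (negPf eDw).
Qed.

Lemma perm_coloring_local (v v' z z' : S) :
  adj v v' -> adj z z' -> perm_coloring v = perm_coloring z ->
  perm_coloring v' = perm_coloring z' -> key c v = key c z.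
Proof.
case: v z => [x|[a h]] [y|[b k]] //.
case: v' z' => [//|ah] [//|bk] xah ybk eq1 eq2; congr Some.
case: ah bk => [a h] [b k] in xah ybk eq2.
have := perm_coloring_joined ybk; rewrite -eq2 (perm_coloring_joined xah).
by case: eq1; case: (c x) (c y) => [p|] [p'|] //= ->.
Qed.

Lemma perm_coloring_thue : thue_coloring perm_coloring.
Proof.
apply: (thue_coloring_subdivision c_thue) => [a|s1 s2].
  by apply: thue_coloring_refine phi_thue => h k [/perm_inj].
apply: key_repetition => m f f_adj _ f_eq i i_lt.
have f_eqS j : j.+1 < m -> perm_coloring (f j.+1) = perm_coloring (f (m + j).+1).
  by rewrite -addnS; apply: f_eq.
(* The deciding neighbour is the successor, or the predecessor at the end of a half; for [m = 1] the
   two vertices are each other's neighbour. *)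
have [iS_lt|iS_ge] := ltnP i.+1 m.
  apply: (perm_coloring_local (f_adj i _) (f_adj (m + i) _) (f_eq i i_lt) (f_eqS i iS_lt));
    by lia.
case: i => [|i] in i_lt iS_ge *; last first.
  have adjS j : j.+1 < m + m -> adj (f j.+1) (f j) by rewrite adj_sym; apply: f_adj.
  rewrite addnS.
  by apply: (perm_coloring_local (adjS i _) (adjS (m + i) _) (f_eqS i i_lt) (f_eq i _)); lia.
have {i_lt iS_ge} m1 : m = 1 by lia.
rewrite m1 /= in f_adj f_eq *; have f01 := f_adj 0 erefl; have E := f_eq 0 erefl.
by apply: (perm_coloring_local f01 _ E (esym E)); rewrite adj_sym.
Qed.

End DistinctColors.

(** * Colouring the subdivision when u and w have the same colour *)

Section EqualColors.
Hypotheses (phi_u : phi u = c0) (phi_w : phi w = c0) (nuw : ~~ adj u w).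

Definition marked a h : bool :=
  (h == u) && (c (val a).1 == None) || (h == w) && (c (val a).2 == None).

Definition mark_coloring (v : S) : P + Q :=
  match v with
  | inl x => if c x is Some g then inl g else inr c0
  | inr (a, h) => if marked a h then inl g0 else inr (phi h)
  end.

Lemma marked_inj a h k : marked a h -> marked a k -> h = k.
Proof.
by case/orP=> /andP[/eqP-> /eqP c1] /orP[] /andP[/eqP-> /eqP c2] //; case: (@arc_None a).
Qed.

Lemma marked_color a h : marked a h -> phi h = c0.
Proof. by case/orP=> /andP[/eqP->]. Qed.

Lemma joined_color x a h : joined u w x a h -> phi h = c0.
Proof. by case/orP=> /andP[_ /eqP->]. Qed.

Lemma joined_marked x a h : joined u w x a h -> marked a h = (c x == None).
Proof.
rewrite /marked; case/orP=> /andP[/eqP-> /eqP->]; rewrite eqxx /=.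
  by rewrite (negPf uDw) orbF.
by rewrite eq_sym (negPf uDw).
Qed.

Lemma joined_inj x y a h : joined u w x a h -> joined u w y a h -> x = y.
Proof.
case/orP=> /andP[/eqP-> /eqP->]; case/orP=> /andP[/eqP-> /eqP E] //;
  by move: uDw; rewrite E eqxx.
Qed.

Lemma adj_marked a h k : adj h k -> marked a h -> marked a k = false /\ phi k != c0.
Proof.
move=> hk mh; have phiDk : phi k != c0.
  by rewrite -(marked_color mh); apply/eqP => E; apply: (thue_coloring_adj phi_thue hk).
by split=> //; apply: contraNF phiDk => /marked_color ->.
Qed.

(** Since [x] is outside M, [h] is unmarked, so a marked [k] would be the other one of [u] and [w];
    these are not adjacent. *)
Lemma adj_joined x a h k : joined u w x a h -> adj h k -> c x != None -> marked a k = false.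
Proof.
move=> xh hk cx; apply/negP => mk; move: hk.
have: ~~ marked a h by rewrite (joined_marked xh).
case/orP: xh mk => /andP[_ /eqP->] /orP[] /andP[/eqP -> ck] nm.
- by rewrite adj_irr.
- by apply/negP.
- by rewrite adj_sym; apply/negP.
- by rewrite adj_irr.
Qed.

(* [mid_key] and [end_key] recover the [key] of the middle and of the first
   vertex of a path of three vertices from the colours [A], [B], [C] on it. *)
Definition mid_key (A B C : P + Q) : option (option P) :=
  match B with
  | inl g => if (A == inr c0) && (C == inr c0) then Some (Some g) else None
  | inr _ => match A, C with inl _, inl _ => Some None | _, _ => None end
  end.

Definition end_key (A B C : P + Q) : option (option P) :=
  match A, B, C with
  | inl g, inr d, inr _ => if d == c0 then Some (Some g) else None
  | inr d, inl _, _ => if (d == c0) && (C != inr c0) then Some None else None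
  | _, _, _ => None
  end.

(** A vertex of a copy has at most one neighbour in G, so [v1] or [v3] lies in the same copy. If the
    vertex is marked, that neighbour does not have colour [c0]; if it is unmarked, two G-coloured
    neighbours would contradict [marked_inj] or [adj_joined]. *)
Lemma mid_keyP (v1 v2 v3 : S) : adj v1 v2 -> adj v2 v3 -> v1 != v3 ->
  key c v2 = mid_key (mark_coloring v1) (mark_coloring v2) (mark_coloring v3).
Proof.
case: v2 => [x|[b k]].
  case: v1 v3 => [//|[a h]] [//|[d l]] /= xh xl _.
  rewrite /mid_key (joined_marked xh) (joined_marked xl) (joined_color xh) (joined_color xl).
  by case E: (c x) => [g|] /=; rewrite /key /= E // eqxx.
rewrite /key /=.
have mixed y h : joined u w y b k -> adj k h ->
  None = mid_key (mark_coloring (inl y)) (mark_coloring (inr (b, k)))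
                 (mark_coloring (inr (b, h))) /\
  None = mid_key (mark_coloring (inr (b, h))) (mark_coloring (inr (b, k)))
                 (mark_coloring (inl y)).
  move=> yk kh; rewrite /mid_key /= (joined_marked yk).
  case E: (c y) => [g|] /=.
    by rewrite (adj_joined yk kh) ?E.
  have mk : marked b k by rewrite (joined_marked yk) E.
  have [-> phih] := adj_marked kh mk.
  by rewrite eqxx (inj_eq inr_inj) (negPf phih).
case: v1 v3 => [x|[a h]] [y|[d l]] /= => [xk yk|xk|+ yk|].
- by rewrite (joined_inj xk yk) eqxx.
- by case/andP=> /eqP <- kl _; have [] := mixed x l xk kl.
- by case/andP=> /eqP -> hk _; have [] := mixed y h yk; rewrite 1?adj_sym.
case/andP=> /eqP -> hk /andP[/eqP <- kl] hDl.
rewrite /mid_key /=; case: ifP => [mk|_].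
  have [-> phih] : marked b h = false /\ phi h != c0 by apply: adj_marked mk; rewrite adj_sym.
  by rewrite (inj_eq inr_inj) (negPf phih).
case: ifP => // mh; case: ifP => // ml.
by rewrite (marked_inj mh ml) eqxx in hDl.
Qed.

(** A G-colour and then [c0] start either outside M, with an H-colour next, or at a marked vertex
    beside M, with another marked vertex next. Colour [c0] and then a G-colour start either in M,
    with a colour other than [c0] next, or in a copy before a vertex outside M, with [c0] next. *)
Lemma end_keyP (v1 v2 v3 : S) : adj v1 v2 -> adj v2 v3 -> v1 != v3 ->
  key c v1 = end_key (mark_coloring v1) (mark_coloring v2) (mark_coloring v3).
Proof.
case: v1 => [x|[a h]].
  case: v2 => [//|[b k]] /= xk.
  case: v3 => [y|[d l]] /=; first by move=> yk; rewrite (joined_inj xk yk) eqxx.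
  case/andP=> /eqP <- kl _; rewrite /key /= (joined_marked xk).
  case E: (c x) => [g|] /=.
    by rewrite (adj_joined xk kl) ?E //= (joined_color xk) eqxx.
  have mk : marked b k by rewrite (joined_marked xk) E.
  have [-> phil] := adj_marked kl mk.
  by rewrite eqxx (inj_eq inr_inj) phil.
rewrite /key /=; case: v2 => [x|[b k]] /=.
  case: v3 => [//|[d l]] /= xh xl _; rewrite (joined_marked xh) (joined_marked xl).
  by case: (c x) => [g|] //=; rewrite (joined_color xl) eqxx andbF.
case/andP=> /eqP <- hk _ _; case: ifP => [mh|nmh].
  have [-> phik] := adj_marked hk mh.
  by rewrite /end_key (negPf phik); case: (mark_coloring v3).
case: ifP => // mk; have [_ phih] : marked a h = false /\ phi h != c0.
  by apply: adj_marked mk; rewrite adj_sym.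
by rewrite /end_key (negPf phih).
Qed.

Lemma mark_coloring_adj (v1 v2 : S) : adj v1 v2 -> mark_coloring v1 != mark_coloring v2.
Proof.
have GH x a h : joined u w x a h -> mark_coloring (inl x) != mark_coloring (inr (a, h)).
  by move=> xh; rewrite /= (joined_marked xh); case: (c x).
case: v1 v2 => [x|[a h]] [y|[b k]] //; [exact: GH | by rewrite eq_sym; apply: GH |].
case/andP=> /eqP <- hk /=; case: ifP => mh; case: ifP => mk //.
  by move: hk; rewrite (marked_inj mh mk) adj_irr.
by rewrite (inj_eq inr_inj); apply/eqP/(thue_coloring_adj phi_thue hk).
Qed.

Lemma key_adj (v1 v2 : S) (p1 p2 : option P) :
  adj v1 v2 -> key c v1 = Some p1 -> key c v2 = Some p2 -> False.
Proof. by case: v1 v2 => [x|[a h]] [y|[b k]]. Qed.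

Lemma key_None (v : S) : key c v = Some None -> mark_coloring v = inr c0.
Proof. by case: v => [x|//] [/= ->]. Qed.

(** Windows of three must cross the midpoint here. If a G-colour and an H-colour alternate, the
    inner H-coloured vertex is in M and has colour [c0]. The inner G-coloured one then lies between
    two colours [c0] and is in G too, but vertices of G are not adjacent in the subdivision. *)
Lemma mark_coloring_square2 (v1 v2 v3 v4 : S) :
  adj v1 v2 -> adj v2 v3 -> adj v3 v4 -> v1 != v3 -> v2 != v4 ->
  mark_coloring v1 = mark_coloring v3 -> mark_coloring v2 = mark_coloring v4 ->
  key c v1 = key c v3 /\ key c v2 = key c v4.
Proof.
move=> a12 a23 a34 n13 n24 e13 e24.
have := end_keyP a12 a23 n13; have := mid_keyP a12 a23 n13.
have := mid_keyP a23 a34 n24.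
have : key c v4 = end_key (mark_coloring v4) (mark_coloring v3) (mark_coloring v2).
  by apply: end_keyP; rewrite 1?adj_sym // eq_sym.
have:= @key_None v3; have := @key_None v2; rewrite -e13 -e24.
case: (mark_coloring v1) (mark_coloring v2) => [g|d] [g'|d'] /=.
- by move=> _ _ -> -> -> ->.
- move=> E _ _ + k2 _; have [->] := E k2; rewrite eqxx => k3.
  by case: (key_adj a23 k2 k3).
- move=> _ E _ k3; have [->] := E k3; rewrite eqxx => k2.
  by case: (key_adj a23 k2 k3).
- by move=> _ _ -> -> -> ->.
Qed.

Lemma mark_coloring_thue : thue_coloring mark_coloring.
Proof.
apply: (thue_coloring_subdivision c_thue) => [a|s1 s2].
  apply: thue_coloring_refine phi_thue => h k /=.
  by case: ifP => mh; case: ifP => mk //; [rewrite (marked_inj mh mk) | case].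
apply: key_repetition => m f f_adj f_neq f_eq i i_lt.
case: m => [//|[|[|m]]] in f_adj f_neq f_eq i_lt *.
- by have /negP[] := mark_coloring_adj (f_adj 0 erefl); apply/eqP/(f_eq 0 erefl).
- have [] := mark_coloring_square2 (f_adj 0 erefl) (f_adj 1 erefl) (f_adj 2 erefl)
    (f_neq 0 erefl) (f_neq 1 erefl) (f_eq 0 erefl) (f_eq 1 erefl).
  by case: i i_lt => [|[|]].
(* From length three on, each position has a window of three inside its half: as an end if it is
   first or last there, as the middle otherwise. *)
move: m.+3 (isT : 2 < m.+3) f_adj f_neq f_eq i_lt => n n_gt2 f_adj f_neq f_eq i_lt.
have f_eqS j : j.+1 < n -> mark_coloring (f (n + j).+1) = mark_coloring (f j.+1).
  by rewrite -addnS => /f_eq.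
have f_eqSS j : j.+2 < n -> mark_coloring (f (n + j).+2) = mark_coloring (f j.+2).
  by rewrite -!addnS => /f_eq.
have adjS j : j.+1 < n + n -> adj (f j.+1) (f j) by rewrite adj_sym; apply: f_adj.
have neqS j : j.+2 < n + n -> f j.+2 != f j by rewrite eq_sym; apply: f_neq.
case: i => [|i] in i_lt *.
  have lt_i : 2 < n + n by apply: ltn_addr.
  have lt_n : (n + 0).+2 < n + n by rewrite -!addnS leq_add2l.
  rewrite (end_keyP (f_adj _ (ltnW lt_i)) (f_adj _ lt_i) (f_neq _ lt_i)).
  rewrite (end_keyP (f_adj _ (ltnW lt_n)) (f_adj _ lt_n) (f_neq _ lt_n)).
  by rewrite f_eqS ?f_eqSS // -?f_eq // ltnW.
have [iSS_lt|iSS_ge] := ltnP i.+2 n.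
  have lt_n : (n + i).+2 < n + n by rewrite -!addnS leq_add2l.
  have lt_i : i.+2 < n + n by apply: ltn_addr.
  rewrite addnS (mid_keyP (f_adj _ (ltnW lt_i)) (f_adj _ lt_i) (f_neq _ lt_i)).
  rewrite (mid_keyP (f_adj _ (ltnW lt_n)) (f_adj _ lt_n) (f_neq _ lt_n)).
  by rewrite f_eqS // f_eqSS // -f_eq // (ltnW (ltnW iSS_lt)).
case: i => [|i] in i_lt iSS_ge *; first by rewrite leqNgt n_gt2 in iSS_ge.
have lt_n : (n + i).+2 < n + n by rewrite -!addnS leq_add2l.
have lt_i : i.+2 < n + n by apply: ltn_addr.
rewrite !addnS (end_keyP (adjS _ lt_i) (adjS _ (ltnW lt_i)) (neqS _ lt_i)).
rewrite (end_keyP (adjS _ lt_n) (adjS _ (ltnW lt_n)) (neqS _ lt_n)).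
by rewrite f_eqS ?f_eqSS // -?f_eq // ltnW // ltnW.
Qed.

End EqualColors.
End Colorings.
End Subdivision.

(** * The bound on the Thue number of the subdivision *)

Theorem theorem4p7 (H : sgraph) (u w : H) (u_neq_w : u != w)
    (dist_uw : dist_geq u w 2) (G : sgraph) (o : rel G) (o_or : orientation o) :
  thue_number (subdivision o u w) <= thue_number G + thue_number H - 1.
Proof.
have nuw := dist_geq2_adj u_neq_w dist_uw.
have [psi psi_thue] := thue_numberP G; have [phi phi_thue] := thue_numberP H.
have phi_gt0 : 0 < thue_number H by apply: leq_trans (ltn_ord (phi u)).
have [n_gt1|n_le1] := ltnP 1 (thue_number G).
  case def_n: (thue_number G) psi psi_thue n_gt1 => [|[|n]] // psi psi_thue _.
  (* The class of [ord_max] becomes M; the other [n.+1] colours are the G-colours. *)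
  pose c := unlift ord_max \o psi.
  have c_thue : thue_coloring c.
    apply: thue_coloring_refine psi_thue => x y; rewrite /c /=.
    by case: unliftP => [i|] ->; case: unliftP => [j|] -> // [->].
  suff [f f_thue] : exists f : subdivision o u w -> 'I_n.+1 + 'I_(thue_number H),
      thue_coloring f.
    by have := thue_number_leq f_thue; rewrite card_sum !card_ord; lia.
  have eq_case (phi' : H -> 'I_(thue_number H)) : thue_coloring phi' ->
      phi' u = phi' w -> exists f : subdivision o u w -> 'I_n.+1 + 'I_(thue_number H),
      thue_coloring f.
    move=> phi'_thue phi'_uw; exists (mark_coloring c phi' ord0 (phi' u)).
    exact: mark_coloring_thue.
  have [/eq_case//|phi_uw] := eqVneq (phi u) (phi w); first exact.
  have [uw|nuw'] := boolP (connect (@adj H) u w).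
    have [e eu ew] := thue_coloring_third_color phi_thue nuw uw phi_uw.
    exists (perm_coloring (u := u) (w := w) c phi ord0 (phi u) e).
    exact: perm_coloring_thue.
  (* With u and w in different components, exchanging their colours on the component of u gives u
     the colour of w. *)
  have glued := thue_coloring_glue (x := u) (@perm_inj _ (tperm (phi u) (phi w))) phi_thue.
  apply: (eq_case _ glued).
  by rewrite connect0 (negPf nuw') tpermL.
(* With at most one colour no [g0] is available, but G has no edges, so the subdivision has no
   copies of H and no edges. *)
have no_arc (a : Defs.arc o) : False.
  apply: (thue_coloring_adj psi_thue (adj_arc o_or a)).
  apply: val_inj; apply/eqP; move: (psi _) (psi _) => [i i_lt] [j j_lt] /=.
  by lia.
(* One colour suffices, but for empty G the bound can be zero, so no colour may be used there. *)
have [x0|no_G] := pickP (@predT G); last first.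
  suff f : subdivision o u w -> 'I_0.
    have f_thue : thue_coloring f.
      by case=> m [v [m_gt0 _ _ _]]; case: (f (tnth v (lshift m (Ordinal m_gt0)))).
    by have := thue_number_leq f_thue; rewrite card_ord; lia.
  by case=> [x|[a _]]; [have := no_G x | case: (no_arc a)].
have f_thue : thue_coloring (fun _ : subdivision o u w => ord0 : 'I_1).
  apply/thue_coloringP => s1 s2 _.
  have nadj (v1 v2 : subdivision o u w) : subdivision_adj u w v1 v2 = false.
    by case: v1 v2 => [x|[a h]] [y|[b k]] //; case: no_arc.
  case: s1 => // v1 [|v2 s1] /=; last by rewrite nadj.
  by case: s2 => // v2 s2; rewrite /= nadj.
have := thue_number_leq f_thue; rewrite card_ord.
have : 0 < thue_number G by apply: leq_trans (ltn_ord (psi x0)).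
by lia.
Qed.
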